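(* Let $(X,P,\mu)$ be a branching Markov chain and let $o\in X$. If there exist a nonnegative function $f:X\to[0,\infty)$ with $f(o)>0$ and some $\varepsilon>0$ such that $$Pf(x)\le\frac{f(x)-\varepsilon}{m(x)}\qquad\text{for all }x\neq o,$$ then $\mathbb{E}_xT_o<\infty$ for all $x\ne o$.
   Context: $X$ is a countably infinite set and $P=(p(x,y))_{x,y\in X}$ is an irreducible stochastic matrix on $X$; $Pf(x):=\sum_y p(x,y)f(y)$, where it is assumed that $P|f|<\infty$. For each $x\in X$, $\mu(x)=(\mu_k(x))_{k\ge 1}$ is a probability distribution on $\{1,2,3,\dots\}$ with finite mean $m(x)=\sum_{k\ge1} k\mu_k(x)$. The branching Markov chain $(X,P,\mu)$ starts with one particle; at each time step each particle, located at $y$ say, is replaced by $k$ offspring with probability $\mu_k(y)$, and each offspring then independently moves to $z$ with probability $p(y,z)$, everything being independent of the other particles and of the past. Let $\eta(n)$ be the number of particles at time $n$ and $x_i(n)$ the position of the $i$-th particle at time $n$; $\mathbb{E}_x$ is the expectation for the process started with one particle at $x$. For $y\in X$, $T_y:=\inf\{n>0:\ \exists\, i\in\{1,\dots,\eta(n)\}:\ x_i(n)=y\}$. *)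

(* Defs.v *)
From HB Require Import structures.
From mathcomp Require Import all_boot all_order all_algebra.
From mathcomp Require Import all_classical all_reals all_analysis.

Set Implicit Arguments.
Unset Strict Implicit.
Unset Printing Implicit Defensive.

Import Order.TTheory GRing.Theory Num.Theory.

Local Open Scope classical_set_scope.
Local Open Scope ring_scope.
Local Open Scope ereal_scope.

Section BranchingMarkovChain.
Context {R : realType} {X : countType}.

Section Data.
Variables (p : X -> X -> R) (mu : X -> nat -> R).

Definition stochastic : Prop :=
  (forall x y, (0 <= p x y)%R) /\
  (forall x, \esum_(y in [set: X]) (p x y)%:E = 1).

Fixpoint nstep (n : nat) (x y : X) : \bar R :=
  if n is m.+1 then \esum_(z in [set: X]) ((p x z)%:E * nstep m z y)
  else (x == y)%:R%:E.

Definition irreducible : Prop := forall x y, exists n, 0 < nstep n x y.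

(* [\esum] is a supremum of finite sums, so this is the sum defining Pf(x)
   only for nonnegative f. *)
Definition transition_op (f : X -> R) (x : X) : \bar R :=
  \esum_(y in [set: X]) (p x y * f y)%:E.

(* The distributions live on {1, 2, ...}: the index 0 carries no mass. *)
Definition offspring_distributions : Prop :=
  forall x, [/\ mu x 0%N = 0%R,
                (forall k, (0 <= mu x k)%R) &
                \sum_(1 <= k <oo) (mu x k)%:E = 1].

Definition emean (x : X) : \bar R := \sum_(1 <= k <oo) (k%:R * mu x k)%:E.

Definition mean (x : X) : R := fine (emean x).

Definition branching_data : Prop :=
  [/\ stochastic, irreducible, offspring_distributions &
      forall x, emean x < +oo].

(* Probability that a particle at y has exactly size s offspring, which move
   to the successive positions listed in s. *)
Definition brood_prob (y : X) (s : seq X) : R :=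
  (mu y (size s) * \prod_(z <- s) p y z)%R.

(* Probability that the particles at the positions listed in c have,
   independently of each other, the broods listed in b. *)
Definition generation_prob (c : seq X) (b : seq (seq X)) : R :=
  if size b == size c
  then (\prod_(ys <- zip c b) brood_prob ys.1 ys.2)%R
  else 0%R.

End Data.

(* Positions at time n, when there is one particle at x at time 0 and
   h k = [:: s_1; ...; s_r] lists, for each of the r particles alive at time k,
   the positions at time k+1 of its offspring. *)
Definition configuration (x : X) (h : nat -> seq (seq X)) (n : nat) : seq X :=
  if n is m.+1 then flatten (h m) else [:: x].

Section Process.
Context {d : measure_display} {Omega : measurableType d}.
Variable Pr : probability Omega R.
Variable broods : nat -> Omega -> seq (seq X).

Definition past (h : nat -> seq (seq X)) (n : nat) : set Omega :=
  [set w | forall k, (k < n)%N -> broods k w = h k].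

(* The process is given by its broods rather than by its positions alone, since
   the positions do not determine who descends from whom. The last clause says
   that, given the whole past up to time n, the next generation is
   distributed according to generation_prob. *)
Definition branching_process (p : X -> X -> R) (mu : X -> nat -> R)
    (x : X) : Prop :=
  (forall n b, measurable [set w | broods n w = b]) /\
  (forall h n, Pr (past h n.+1) =
     Pr (past h n) * (generation_prob p mu (configuration x h n) (h n))%:E).

Definition particles (x : X) (n : nat) (w : Omega) : seq X :=
  configuration x (fun k => broods k w) n.

(* The infimum of the empty set is +oo. *)
Definition hitting_time (x y : X) (w : Omega) : \bar R :=
  ereal_inf [set n%:R%:E | n in [set n | (0 < n)%N /\ y \in particles x n w]].

End Process.
End BranchingMarkovChain.

(* Main.v *)
Require Import Defs.
From HB Require Import structures.
From mathcomp Require Import all_boot all_order all_algebra.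
From mathcomp Require Import all_classical all_reals all_analysis.
From mathcomp Require Import measurable_realfun.

(** The total F(c) = sum of f over the particles of a configuration c is a
    Lyapunov function.  A particle at y <> o has on average m(y) children, each
    contributing Pf(y) on average to the next total; since
    m(y) Pf(y) <= f(y) - eps, replacing c by its offspring lowers the expected
    total by at least eps per particle, hence by at least eps as long as c is
    nonempty and does not meet o.  The population never dies out because every
    particle has at least one child.  A nonnegative quantity that starts at f(x)
    and loses eps on average at each step before T_o satisfies
    eps * E_x T_o <= f(x).

    Conditional expectations are avoided by working on the cylinder events
    [past broods h m], on which the configuration at time m is known.
    [survival_sum_le] bounds the expected number of further steps before o is
    met, truncated at n, by induction on n: one step splits a cylinder along the
    next generation of broods, and [generation_drift] pays for that step.

    The mean total of the next generation is a double sum of independent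
    choices: a brood is a word of independent positions, and a generation is a
    word of independent broods.  Both levels are instances of
    [esum_word_additive], the linearity of expectation for an additive
    functional of a word with independent letters.  Finally E T_o is the sum of
    the survival probabilities ([integral_hitting_time]). *)

Set Implicit Arguments.
Unset Strict Implicit.
Unset Printing Implicit Defensive.

Import Order.TTheory GRing.Theory Num.Theory.

Local Open Scope classical_set_scope.
Local Open Scope ring_scope.
Local Open Scope ereal_scope.

(** * Sums and measures over countable types *)

Lemma esumZl (R : realType) (T : choiceType) (D : set T) (c : R)
    (a : T -> \bar R) : (0 <= c)%R -> (forall t, 0 <= a t) ->
  \esum_(t in D) (c%:E * a t) = c%:E * \esum_(t in D) a t.
Proof.
move=> c0 a0; rewrite /esum -ereal_supZl//.
  congr ereal_sup; rewrite image_comp; apply: eq_imagel => A _ /=.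
  by rewrite ge0_mule_fsumr.
apply/set0P; exists (\sum_(t \in set0) a t).
by exists set0 => //; exact: fsets_set0.
Qed.

Lemma EFin_mule_le (R : realType) (c : R) (x : \bar R) :
  (0 <= c)%R -> x <= 1 -> c%:E * x <= c%:E.
Proof. by move=> c0 x1; rewrite -[leRHS]mule1 lee_wpmul2l. Qed.

Lemma esum_subset (R : realType) (T : choiceType) (D : set T)
    (a : T -> \bar R) : (forall t, 0 <= a t) ->
  \esum_(t in D) a t <= \esum_(t in [set: T]) a t.
Proof.
by move=> a0; rewrite esum_mkcond; apply: le_esum => t _; case: ifP.
Qed.

(** Countable subadditivity for a family indexed by any countable type: the
    codes of its elements index the same family, completed by empty sets. *)
Lemma measure_le_esum d (Omega : measurableType d) (R : realType)
    (P : {measure set Omega -> \bar R}) (T : countType) (D : set T)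
    (A : set Omega) (F : T -> set Omega) :
  measurable A -> (forall t, measurable (F t)) -> A `<=` \bigcup_(t in D) F t ->
  P A <= \esum_(t in D) P (F t).
Proof.
move=> mA mF AF.
pose G n := if pickle_inv n is Some t then (if t \in D then F t else set0)
            else set0 : set Omega.
have GP t : G (pickle t) = if t \in D then F t else set0.
  by rewrite /G pickleK_inv.
have mG n : measurable (G n).
  rewrite /G; case: pickle_inv => // t; case: ifP => // _; exact: measurable0.
have AG : A `<=` \bigcup_n G n.
  move=> w /AF[t Dt Ft]; exists (pickle t) => //.
  by rewrite GP mem_set.
have PA : P A <= \sum_(n <oo) P (G n) by exact: measure_sigma_subadditive.
apply: le_trans PA _.
rewrite nneseries_esumT// [leRHS]esum_mkcond.
have -> : \esum_(t in [set: T]) (if t \in D then P (F t) else 0) =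
          \esum_(n in range (@pickle T)) P (G n).
  rewrite esum_image; last by move=> s t _ _; exact: (pcan_inj pickleK).
  by apply: eq_esum => t _; rewrite GP; case: ifP => // _; rewrite measure0.
rewrite [leRHS]esum_mkcond; apply: le_esum => n _.
case: ifPn => // /negP nP; rewrite /G.
case E: (pickle_inv n) => [t|]; last by rewrite measure0.
exfalso; apply: nP; rewrite inE; exists t => //.
by have := @pickle_invK T n; rewrite /oapp E.
Qed.

(** * Words with independent letters *)

Section Words.
Context {R : realType}.

Lemma esum_seqS (T : choiceType) (k : nat) (a : seq T -> \bar R) :
  (forall s, 0 <= a s) ->
  \esum_(s in [set s | size s = k.+1]) a s =
  \esum_(t in [set: T]) \esum_(s in [set s | size s = k]) a (t :: s).
Proof.
move=> a0; rewrite esum_esum//.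
apply: (reindex_esum _ _ (fun u : T * seq T => u.1 :: u.2)).
split.
- by move=> [t s] /= [_ ->].
- by move=> [t s] [t' s'] _ _ /= [-> ->].
- by move=> [|t s] //= [sk]; exists (t, s).
Qed.

Lemma esum_seq_nil (T : choiceType) (a : seq T -> \bar R) : 0 <= a [::] ->
  \esum_(s in [set s | size s = 0%N]) a s = a [::].
Proof.
move=> a0; rewrite (_ : [set _ | _] = [set [::]]) ?esum_set1//.
by apply/seteqP; split=> [[]|_ ->].
Qed.

Context {I : eqType} {T : countType}.
Variable w : I -> T -> R.
Hypothesis w_ge0 : forall i t, (0 <= w i t)%R.
Hypothesis w_le1 : forall i, \esum_(t in [set: T]) (w i t)%:E <= 1.

Definition word_weight (r : seq I) (s : seq T) : R :=
  (\prod_(u <- zip r s) w u.1 u.2)%R.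

Lemma word_weight_ge0 r s : (0 <= word_weight r s)%R.
Proof. by apply: prodr_ge0 => u _. Qed.

Lemma esum_word_weight (r : seq I) :
  \esum_(s in [set s | size s = size r]) (word_weight r s)%:E <= 1.
Proof.
have ww0 r' s : 0 <= (word_weight r' s)%:E by rewrite lee_fin word_weight_ge0.
elim: r => [|i r IH] /=.
  by rewrite esum_seq_nil// /word_weight big_nil.
rewrite esum_seqS//; apply: le_trans (w_le1 i); apply: le_esum => t _.
under eq_esum do rewrite /word_weight /= big_cons EFinM.
rewrite esumZl//; first exact: EFin_mule_le.
exact: ww0.
Qed.

(** Linearity of expectation: letter number i has law [w i], so it contributes
    at most [B i] on average, and the other letters, of total mass at most 1,
    do not increase its contribution.  The means are only bounded by reals,
    which keeps infinite values out of the products. *)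
Lemma esum_word_additive (g : T -> R) (B : I -> R) (r : seq I) :
  (forall t, (0 <= g t)%R) ->
  (forall i, i \in r -> \esum_(t in [set: T]) (w i t * g t)%:E <= (B i)%:E) ->
  \esum_(s in [set s | size s = size r])
    (word_weight r s * \sum_(t <- s) g t)%:E <= (\sum_(i <- r) B i)%:E.
Proof.
move=> g0.
have G0 s : (0 <= \sum_(t <- s) g t)%R by apply: sumr_ge0.
elim: r => [|i r IH] /= Bb.
  by rewrite esum_seq_nil /word_weight !big_nil ?mulr0.
have a0 r' s : 0 <= (word_weight r' s * \sum_(t <- s) g t)%:E.
  by rewrite lee_fin mulr_ge0// word_weight_ge0.
have wg0 t : 0 <= (w i t * g t)%:E by rewrite lee_fin mulr_ge0.
have {}IH := IH (fun j jr => Bb j (mem_behead (s := i :: r) jr)).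
have S0 : (0 <= \sum_(j <- r) B j)%R.
  by rewrite -lee_fin; apply: le_trans IH; apply: esum_ge0.
rewrite esum_seqS// big_cons EFinD.
apply: (@le_trans _ _ (\esum_(t in [set: T])
    ((w i t * g t)%:E + (\sum_(j <- r) B j)%:E * (w i t)%:E))).
  apply: le_esum => t _.
  have split_head s : (word_weight (i :: r) (t :: s) *
      \sum_(u <- t :: s) g u)%:E =
      (w i t * g t)%:E * (word_weight r s)%:E +
      (w i t)%:E * (word_weight r s * \sum_(u <- s) g u)%:E.
    rewrite -!EFinM -EFinD /word_weight /= !big_cons /=; congr EFin.
    by rewrite mulrDr mulrAC mulrA.
  under eq_esum do rewrite split_head.
  rewrite esumD; first last.
  - by move=> s _; rewrite mule_ge0// lee_fin.
  - by move=> s _; rewrite mule_ge0// lee_fin// word_weight_ge0.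
  rewrite !esumZl//; last by move=> s; rewrite lee_fin word_weight_ge0.
    rewrite (muleC (_ (\sum_(j <- r) B j)%R)) leeD//.
      by apply: EFin_mule_le; [rewrite mulr_ge0|exact: esum_word_weight].
    by rewrite lee_pmul// ?lee_fin//; apply: esum_ge0.
  by rewrite mulr_ge0.
rewrite esumD//; last by move=> t _; rewrite mule_ge0// lee_fin.
rewrite esumZl//; last by move=> t; rewrite lee_fin.
rewrite leeD//; first by apply: Bb; rewrite mem_head.
exact: EFin_mule_le.
Qed.

End Words.

Lemma esum_seq_by_size (R : realType) (T : choiceType) (a : seq T -> \bar R) :
  (forall s, 0 <= a s) ->
  \esum_(s in [set: seq T]) a s =
  \sum_(0 <= k <oo) \esum_(s in [set s | size s = k]) a s.
Proof.
move=> a0; rewrite -nneseries_sum_bigcup//.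
  congr esum; apply/seteqP; split=> // s _.
  by exists (size s).
by move=> i j _ _ [s [/= <- <-]].
Qed.

(** * Mean change of an additive functional in one generation *)

Section Branching.
Context {R : realType} {X : countType}.
Variables (p : X -> X -> R) (mu : X -> nat -> R).
Hypothesis stoch : stochastic p.
Hypothesis offspring : offspring_distributions mu.

Let p_ge0 x y : (0 <= p x y)%R. Proof. by case: stoch. Qed.
Let p_le1 x : \esum_(y in [set: X]) (p x y)%:E <= 1.
Proof. by case: stoch => _ ->. Qed.
Let mu_ge0 x k : (0 <= mu x k)%R. Proof. by case: (offspring x). Qed.

Lemma eseries_from1 (u : nat -> \bar R) : u 0%N = 0 ->
  \sum_(0 <= k <oo) u k = \sum_(1 <= k <oo) u k.
Proof.
move=> u0; rewrite [RHS]eseries_cond [RHS]eseries_mkcond.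
by apply: eq_eseriesr => -[|k].
Qed.

(** Given its size, a brood is a word of independent letters that all have the
    law p(y, .), which is why the index word is constant. *)
Lemma brood_probE y s :
  brood_prob p mu y s = (mu y (size s) * word_weight p (nseq (size s) y) s)%R.
Proof.
congr (_ * _)%R; rewrite /word_weight.
by elim: s => [|z s IH] /=; rewrite ?big_nil// !big_cons IH.
Qed.

Lemma brood_prob_ge0 y s : (0 <= brood_prob p mu y s)%R.
Proof. by rewrite brood_probE mulr_ge0// word_weight_ge0. Qed.

Lemma esum_brood_prob y :
  \esum_(s in [set: seq X]) (brood_prob p mu y s)%:E <= 1.
Proof.
have [mu0 _ mu1] := offspring y.
rewrite esum_seq_by_size; last by move=> s; rewrite lee_fin brood_prob_ge0.
apply: (@le_trans _ _ (\sum_(0 <= k <oo) (mu y k)%:E)); last first.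
  by rewrite eseries_from1 ?mu0// mu1.
apply: lee_nneseries => [k _ _|k _].
  by apply: esum_ge0 => s _; rewrite lee_fin brood_prob_ge0.
rewrite (eq_esum (b := fun s =>
  (mu y k)%:E * (word_weight p (nseq k y) s)%:E)); last first.
  by move=> s <-; rewrite brood_probE EFinM.
rewrite esumZl//; last by move=> s; rewrite lee_fin word_weight_ge0.
apply: EFin_mule_le => //.
by rewrite -{1}(size_nseq k y) esum_word_weight.
Qed.

(** Wald's identity for one brood, as an upper bound: conditionally on having k
    members, it contributes k times the mean Pf(y) of one member. *)
Lemma esum_brood_additive (f : X -> R) (y : X) (r : R) :
  (forall z, (0 <= f z)%R) -> transition_op p f y <= r%:E ->
  \esum_(s in [set: seq X]) (brood_prob p mu y s * \sum_(z <- s) f z)%:E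
    <= r%:E * emean mu y.
Proof.
move=> f0 Pf.
have F0 s : (0 <= \sum_(z <- s) f z)%R by apply: sumr_ge0.
have r0 : (0 <= r)%R.
  rewrite -lee_fin; apply: le_trans Pf; apply: esum_ge0 => z _.
  by rewrite lee_fin mulr_ge0.
have bF0 s : 0 <= (brood_prob p mu y s * \sum_(z <- s) f z)%:E.
  by rewrite lee_fin mulr_ge0// brood_prob_ge0.
rewrite esum_seq_by_size//.
apply: (@le_trans _ _ (\sum_(0 <= k <oo) (r%:E * (k%:R * mu y k)%:E))).
  apply: lee_nneseries => [k _ _|k _]; first exact: esum_ge0.
  rewrite (eq_esum (b := fun s => (mu y k)%:E *
    (word_weight p (nseq k y) s * \sum_(z <- s) f z)%:E)); last first.
    by move=> s <-; rewrite brood_probE -mulrA EFinM.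
  rewrite esumZl//; last first.
    by move=> s; rewrite lee_fin mulr_ge0// word_weight_ge0.
  rewrite -EFinM mulrA (mulrC (r * _)%R) EFinM lee_wpmul2l ?lee_fin//.
  rewrite -{1}(size_nseq k y).
  have -> : (r * k%:R = \sum_(i <- nseq k y) r)%R.
    by rewrite big_nseq iter_addr_0 mulr_natr.
  apply: esum_word_additive => // z.
  by rewrite mem_nseq => /andP[_ /eqP ->].
rewrite nneseriesZl//; last by move=> k _; rewrite lee_fin mulr_ge0.
by rewrite eseries_from1// mul0r.
Qed.

Lemma emean_ge1 y : 1 <= emean mu y.
Proof.
have [_ _ <-] := offspring y.
rewrite /emean !(eseries_cond _ xpredT).
apply: lee_nneseries => [k _ _|k /= k1]; first by rewrite lee_fin.
by rewrite lee_fin ler_peMl// ler1n.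
Qed.

(** A generation is a word whose letters are broods. *)
Lemma generation_probE c b : generation_prob p mu c b =
  if size b == size c then word_weight (brood_prob p mu) c b else 0%R.
Proof. by []. Qed.

Lemma generation_prob_ge0 c b : (0 <= generation_prob p mu c b)%R.
Proof.
rewrite generation_probE; case: ifP => // _.
by apply: word_weight_ge0 => *; exact: brood_prob_ge0.
Qed.

(** The first particle of c has a child, since offspring laws do not charge 0. *)
Lemma generation_prob_nonempty c b : c != [::] ->
  generation_prob p mu c b != 0%R -> flatten b != [::].
Proof.
case: c => // y c _; rewrite generation_probE; case: b => [|s b] //=.
  by rewrite eqxx.
case: ifP => _; last by rewrite eqxx.
case: s => //=; rewrite /word_weight /= big_cons /=.
by have [mu0 _ _] := offspring y; rewrite /brood_prob /= mu0 !mul0r eqxx.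
Qed.

Lemma esum_generation_additive (f B : X -> R) (c : seq X) :
  (forall z, (0 <= f z)%R) ->
  (forall y, y \in c -> \esum_(s in [set: seq X])
     (brood_prob p mu y s * \sum_(z <- s) f z)%:E <= (B y)%:E) ->
  \esum_(b in [set: seq (seq X)])
    (generation_prob p mu c b * \sum_(z <- flatten b) f z)%:E
  <= (\sum_(y <- c) B y)%:E.
Proof.
move=> f0 fB.
have F0 s : (0 <= \sum_(z <- s) f z)%R by apply: sumr_ge0.
apply: le_trans (esum_word_additive brood_prob_ge0 esum_brood_prob F0 fB).
rewrite [leRHS]esum_mkcond; apply: le_esum => b _.
rewrite generation_probE big_flatten/=.
case: (eqVneq (size b) (size c)) => bc; first by rewrite mem_set.
by rewrite mul0r memNset//; exact/eqP.
Qed.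

End Branching.

(** * Survival probabilities and the hitting time *)

Section Hitting.
Context {R : realType} {X : countType}.
Variables (p : X -> X -> R) (mu : X -> nat -> R).
Hypothesis stoch : stochastic p.
Hypothesis offspring : offspring_distributions mu.
Context {d : measure_display} {Omega : measurableType d}.
Variable Pr : probability Omega R.
Variable broods : nat -> Omega -> seq (seq X).
Variables x o : X.

Definition avoids (m n : nat) : set Omega :=
  [set w | forall j, (m < j <= n)%N -> o \notin particles broods x j w].

Hypothesis proc : branching_process Pr broods p mu x.

Let measurable_broods n b : measurable [set w | broods n w = b].
Proof. by case: proc. Qed.

Let Pr_pastS h n : Pr (past broods h n.+1) =
  Pr (past broods h n) *
  (generation_prob p mu (configuration x h n) (h n))%:E.
Proof. by case: proc. Qed.

Lemma measurable_past h n : measurable (past broods h n).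
Proof.
have -> : past broods h n =
    \bigcap_(k in [set k | (k < n)%N]) [set w | broods k w = h k].
  by apply/seteqP; split.
exact: bigcap_measurableType.
Qed.

Lemma measurable_notin n :
  measurable [set w | o \notin particles broods x n w].
Proof.
case: n => [|n].
  rewrite /particles /=; have [E|/negP E] := boolP (o \notin [:: x]).
    by rewrite (_ : [set _ | _] = setT)//; apply/seteqP; split.
  by rewrite (_ : [set _ | _] = set0)//; apply/seteqP; split.
rewrite (_ : [set _ | _] = \bigcup_(b in [set b | o \notin flatten b])
  [set w | broods n w = b]); last first.
  apply/seteqP; split=> [w /= ow|w [b /= ob bE]].
    by exists (broods n w).
  by rewrite /particles /= bE.
rewrite bigcup_mkcond; apply: countable_bigcupT_measurable => [|b].
  exact: countableP.
by case: ifP => // _; exact: measurable0.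
Qed.

Lemma measurable_avoids m n : measurable (avoids m n).
Proof.
have -> : avoids m n = \bigcap_(j in [set j | (m < j <= n)%N])
    [set w | o \notin particles broods x j w].
  by apply/seteqP; split.
by apply: bigcap_measurableType => j _; exact: measurable_notin.
Qed.

(** A history of which only the first n entries matter is extended by the
    generation b; the function is changed at n and left alone beyond. *)
Definition next_broods (h : nat -> seq (seq X)) n b : nat -> seq (seq X) :=
  fun k => if k == n then b else h k.

Lemma Pr_past_next h n b : Pr (past broods (next_broods h n b) n.+1) =
  Pr (past broods h n) * (generation_prob p mu (configuration x h n) b)%:E.
Proof.
rewrite Pr_pastS /next_broods eqxx.
have -> : past broods (next_broods h n b) n = past broods h n.
  by apply/seteqP; split=> w /= H k kn; move: (H k kn); rewrite /next_broods;
    rewrite (ltn_eqF kn).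
by case: n => [|n] //=; rewrite ltn_eqF.
Qed.

(** Splitting along the generation born at time m: it must itself avoid o, and
    from then on one step fewer of avoidance is left. *)
Lemma past_avoids_next h m n :
  past broods h m `&` avoids m (m + n.+1) `<=`
  \bigcup_(b in [set b | o \notin flatten b])
    (past broods (next_broods h m b) m.+1 `&`
     avoids m.+1 (m.+1 + n)).
Proof.
move=> w [hw ow]; exists (broods m w) => /=.
  by apply: (ow m.+1); rewrite ltnS leqnn addnS ltnS leq_addr.
split=> k; last first.
  by rewrite addSnnS => /andP[mk kn]; apply: ow; rewrite kn (ltnW mk).
rewrite ltnS leq_eqVlt /next_broods; have [->//|km /=] := eqVneq k m.
exact: hw.
Qed.

Lemma past_nonempty h n : Pr (past broods h n) != 0 ->
  configuration x h n != [::].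
Proof.
elim: n => [//|n IH]; rewrite Pr_pastS mule_eq0 negb_or => /andP[/IH c0].
exact: generation_prob_nonempty.
Qed.

Variables (f : X -> R) (eps : R).
Hypothesis f_ge0 : forall y, (0 <= f y)%R.
Hypothesis eps_ge0 : (0 <= eps)%R.
Hypothesis drift : forall y, y != o -> \esum_(s in [set: seq X])
  (brood_prob p mu y s * \sum_(z <- s) f z)%:E <= (f y - eps)%:E.

(** The total loses at least eps on average for each particle of c; nonemptiness
    of c provides the one eps that is kept, the other losses are discarded. *)
Lemma generation_drift (c : seq X) : o \notin c -> c != [::] ->
  eps%:E + \esum_(b in [set: seq (seq X)])
    (generation_prob p mu c b * \sum_(z <- flatten b) f z)%:E
  <= (\sum_(y <- c) f y)%:E.
Proof.
move=> oc c0.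
have cB y : y \in c -> \esum_(s in [set: seq X])
    (brood_prob p mu y s * \sum_(z <- s) f z)%:E <= (f y - eps)%:E.
  by move=> yc; apply: drift; apply: contraNneq oc => <-.
apply: le_trans (leeD2l _
  (esum_generation_additive stoch offspring f_ge0 cB)) _.
rewrite -EFinD lee_fin big_split /= addrCA gerDl.
case: c c0 {oc cB} => // y c _; rewrite big_cons addrA subrr add0r.
by apply: sumr_le0 => z _; rewrite oppr_le0.
Qed.

(** The left side is eps times the expectation, on the cylinder, of the number
    of steps before o is met after time m, truncated at n.  The term j = 0 is
    the step being taken; after the splitting of [past_avoids_next] the other
    terms are the same quantity for the longer cylinders, one step shorter. *)
Lemma survival_sum_le n h m : o \notin configuration x h m ->
  \sum_(0 <= j < n)
    (eps%:E * Pr (past broods h m `&` avoids m (m + j)))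
  <= Pr (past broods h m) * (\sum_(y <- configuration x h m) f y)%:E.
Proof.
have F0 (c : seq X) : (0 <= \sum_(y <- c) f y)%R by apply: sumr_ge0.
elim: n h m => [|n IH] h m oc.
  by rewrite big_nil mule_ge0// lee_fin.
have mpa h' m' n' :
    measurable (past broods h' m' `&` avoids m' n').
  by apply: measurableI; [exact: measurable_past|exact: measurable_avoids].
have past_ge j : Pr (past broods h m `&` avoids m j) <= Pr (past broods h m).
  apply: le_measure; rewrite ?inE//; exact: measurable_past.
(* On a null cylinder the configuration may be empty, and then no step lowers
   the total; but there both sides vanish. *)
have [P0|P0] := eqVneq (Pr (past broods h m)) 0.
  rewrite P0 mul0e big1// => j _.
  have := past_ge (m + j)%N; rewrite P0 measure_le0 => /eqP ->.
  by rewrite mule0.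
have c0 := past_nonempty P0.
set c := configuration x h m in oc c0 *.
have fin : Pr (past broods h m) \is a fin_num.
  exact: fin_num_measure (measurable_past _ _).
have q0 : (0 <= fine (Pr (past broods h m)))%R by exact: fine_ge0.
have qE : Pr (past broods h m) = (fine (Pr (past broods h m)))%:E.
  by rewrite fineK.
set q := fine _ in q0 qE.
have gF0 b : 0 <= (generation_prob p mu c b * \sum_(z <- flatten b) f z)%:E.
  by rewrite lee_fin mulr_ge0// generation_prob_ge0.
apply: (@le_trans _ _ (q%:E * (eps%:E + \esum_(b in [set: seq (seq X)])
    (generation_prob p mu c b * \sum_(z <- flatten b) f z)%:E))); last first.
  by rewrite qE lee_wpmul2l//; exact: generation_drift.
rewrite big_nat_recl// ge0_muleDr//; last exact: esum_ge0.
apply: leeD.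
  rewrite muleC lee_wpmul2r ?lee_fin// -qE.
  exact: past_ge.
pose D := [set b : seq (seq X) | o \notin flatten b].
apply: (@le_trans _ _ (\sum_(0 <= j < n) \esum_(b in D)
  (eps%:E * Pr (past broods (next_broods h m b) m.+1 `&`
           avoids m.+1 (m.+1 + j))))).
  apply: lee_sum => j _; rewrite esumZl//.
  rewrite lee_wpmul2l ?lee_fin//.
  by apply: measure_le_esum => //; exact: past_avoids_next.
rewrite -esum_sum; last by move=> b j _ _; rewrite mule_ge0.
rewrite -esumZl//.
apply: le_trans (esum_subset _ _); last first.
  by move=> b; rewrite mule_ge0.
apply: le_esum => b Db; apply: le_trans (IH _ _ _) _.
  by rewrite /= /next_broods eqxx.
by rewrite Pr_past_next /= /next_broods eqxx -muleA -EFinM qE.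
Qed.

(** T_o counts the times n with n < T_o, including when it is infinite. *)
Lemma hitting_timeE w : hitting_time broods x o w =
  \sum_(0 <= n <oo) (\1_(avoids 0 n) w : R)%:E.
Proof.
have ind0 n : 0 <= (\1_(avoids 0 n) w : R)%:E by rewrite lee_fin.
have sum1 k : \sum_(0 <= j < k) 1 = k%:R%:E :> \bar R.
  by rewrite (sumEFin _ _ (fun=> 1%R)) sumr_const_nat subn0.
rewrite /hitting_time.
have [hits|nohit] :=
  pselect (exists n, (0 < n)%N && (o \in particles broods x n w)).
  case: (ex_minnP hits) => N /andP[N0 oN] Nmin.
  rewrite (nneseries_split _ N)// [X in _ + X]eseries0 => [|n Nn _]; last first.
    rewrite indicE memNset//= => /(_ N).
    by rewrite add0n in Nn; rewrite N0 Nn oN => /(_ isT).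
  rewrite adde0 add0n (eq_big_nat _ _ (F2 := fun=> 1)) => [|n /andP[_ nN]].
    rewrite sum1.
    apply/eqP; rewrite eq_le; apply/andP; split.
      by apply: ereal_inf_lbound; exists N.
    apply/ereal_infP => _ [n [n0 on] <-]; rewrite lee_fin ler_nat.
    by apply: Nmin; rewrite n0.
  rewrite indicE mem_set// => j /andP[j0 jn]; apply/negP => oj.
  have := Nmin j; rewrite j0 oj => /(_ isT).
  by rewrite leqNgt (leq_ltn_trans jn nN).
rewrite (_ : [set _ | _ in _] = set0); last first.
  apply/seteqP; split=> // y [n [n0 on] _] /=; case: nohit.
  by exists n; rewrite n0.
rewrite ereal_inf0; apply/esym/eqyP => r r0.
pose n := (Num.truncn r).+1.
apply: le_trans (nneseries_lim_ge n (fun k _ _ => ind0 k)).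
rewrite (eq_bigr (fun=> 1)) => [|k _].
  rewrite sum1 lee_fin ltW//.
  exact: truncnS_gt.
rewrite indicE mem_set// => j /andP[j0 _]; apply/negP => oj.
by apply: nohit; exists j; rewrite j0.
Qed.

Lemma integral_hitting_time :
  \int[Pr]_w hitting_time broods x o w =
  \sum_(0 <= n <oo) Pr (avoids 0 n).
Proof.
under eq_integral do rewrite hitting_timeE.
rewrite integral_nneseries//.
- apply: eq_eseriesr => n _; rewrite integral_indic ?setIT//.
  exact: measurable_avoids.
- move=> n; apply/measurable_EFinP; apply: measurable_indic.
  exact: measurable_avoids.
Qed.

Lemma integral_hitting_time_le : x != o ->
  eps%:E * \int[Pr]_w hitting_time broods x o w <= (f x)%:E.
Proof.
move=> xo; rewrite integral_hitting_time -nneseriesZl//.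
apply: lime_le; first by apply: is_cvg_nneseries => n _ _; rewrite mule_ge0.
apply: nearW => n.
have past0 h : past broods h 0 = setT by apply/seteqP; split.
have /(survival_sum_le n) : o \notin configuration x (fun=> [::]) 0.
  by rewrite inE eq_sym.
rewrite past0 probability_setT mul1e /= big_seq1; apply: le_trans.
by apply: lee_sum => j _; rewrite setTI.
Qed.

End Hitting.

Theorem theorem4p4 (R : realType) (X : countType)
    (X_infinite : infinite_set [set: X])
    (p : X -> X -> R) (mu : X -> nat -> R) (bmc : branching_data p mu)
    (o : X) :
  (exists (f : X -> R) (eps : R),
     [/\ forall x, (0 <= f x)%R,
         (0 < f o)%R,
         (0 < eps)%R,
         forall x, transition_op p (fun y => `|f y|%R) x < +oo &
         forall x, x <> o ->
           transition_op p f x <= ((f x - eps) / mean mu x)%:E]) ->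
  forall x : X, x <> o ->
  forall (d : measure_display) (Omega : measurableType d)
    (Pr : probability Omega R) (broods : nat -> Omega -> seq (seq X)),
  branching_process Pr broods p mu x ->
  \int[Pr]_w hitting_time broods x o w < +oo.
Proof.
case: bmc => stoch _ offspring mean_fin [f [eps [f0 _ eps0 _ Pf]]] x /eqP xo.
move=> d Omega Pr broods proc.
have drift y : y != o -> \esum_(s in [set: seq X])
    (brood_prob p mu y s * \sum_(z <- s) f z)%:E <= (f y - eps)%:E.
  move=> /eqP yo.
  have m1 := emean_ge1 offspring y.
  have mE : emean mu y = (mean mu y)%:E.
    rewrite /mean fineK// ge0_fin_numE//.
    exact: le_trans m1.
  have m0 : mean mu y != 0%R.
    by rewrite gt_eqF// (lt_le_trans ltr01)// -lee_fin -mE.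
  apply: le_trans (esum_brood_additive stoch offspring f0 (Pf y yo)) _.
  by rewrite mE -EFinM mulfVK.
have := integral_hitting_time_le stoch offspring proc f0 (ltW eps0) drift xo.
rewrite -lee_pdivlMl// => /le_lt_trans; apply.
by rewrite ltry.
Qed.
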